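(* Let $X_1$ and $X_2$ be two strong fuzzy incidence graphs such that the maximum of the weights of the pairs in $X_1$ is less than or equal to the minimum of the weights of the pairs in $X_2$. Then the composition $X_1[X_2]$ is a strong fuzzy incidence graph.
   Context: Fuzzy incidence graphs. All graphs are finite, simple and undirected; $\wedge$ denotes minimum. A fuzzy incidence graph (FIG) $X=(V,E,I,\varepsilon,\rho,\eta)$ consists of a nonempty finite vertex set $V$, a set $E$ of edges $xy=yx$ ($x\neq y$ in $V$), a set $I$ of (incidence) pairs $(x,xy)$ with $xy\in E$ and $x$ an endpoint of $xy$, and functions $\varepsilon:V\to(0,1]$, $\rho:E\to(0,1]$, $\eta:I\to(0,1]$ with $\rho(xy)\le\varepsilon(x)\wedge\varepsilon(y)$ for all $xy\in E$ and $\eta(x,xy)\le\varepsilon(x)\wedge\rho(xy)$ for all $(x,xy)\in I$ (vertices, edges, pairs of weight $0$ are regarded as absent). The number $\eta(x,xy)$ is the weight of the pair $(x,xy)$. Strong pairs. For $(a,ab)\in I$, an incidence path from $a$ to $ab$ in $X\setminus(a,ab)$ is a sequence $x_0=a,(x_0,x_0x_1),x_0x_1,(x_1,x_0x_1),x_1,\dots,x_k=b,(b,ab),ab$ with $k\ge2$, the vertices $x_0,\dots,x_k$ distinct, and all listed edges in $E$ and pairs in $I$; its incidence strength is the minimum weight of its pairs. $ICONN_{X\setminus(a,ab)}(a,ab)$ is the maximum incidence strength over all such paths ($0$ if there are none). The pair $(a,ab)$ is strong if $\eta(a,ab)\ge ICONN_{X\setminus(a,ab)}(a,ab)$. A strong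 fuzzy incidence graph (SFIG) is a FIG all of whose pairs are strong. Composition. For FIGs $X_i=(V_i,E_i,I_i,\varepsilon_i,\rho_i,\eta_i)$, $i=1,2$, the composition $X_1[X_2]=(V,E,I,\varepsilon,\rho,\eta)$ has $V=V_1\times V_2$; $E=\{(a_1,b_1)(a_2,b_2): a_1=a_2,\ b_1b_2\in E_2\ \text{or}\ a_1a_2\in E_1\}$; $I$ is the set of pairs $((a_1,b_1),(a_1,b_1)(a_2,b_2))$ such that either $a_1=a_2$ and both $(b_1,b_1b_2),(b_2,b_1b_2)\in I_2$, or both $(a_1,a_1a_2),(a_2,a_1a_2)\in I_1$; $\varepsilon(a,b)=\varepsilon_1(a)\wedge\varepsilon_2(b)$; $\rho((a_1,b_1)(a_2,b_2))$ equals $\varepsilon_1(a_1)\wedge\rho_2(b_1b_2)$ if $a_1=a_2$, $\rho_1(a_1a_2)\wedge\varepsilon_2(b_1)$ if $a_1a_2\in E_1,b_1=b_2$, and $\rho_1(a_1a_2)\wedge\varepsilon_2(b_1)\wedge\varepsilon_2(b_2)$ if $a_1a_2\in E_1,b_1\ne b_2$; $\eta((a_1,b_1),(a_1,b_1)(a_2,b_2))$ equals $\varepsilon_1(a_1)\wedge\eta_2(b_1,b_1b_2)$ if $a_1=a_2$, $\eta_1(a_1,a_1a_2)\wedge\varepsilon_2(b_1)$ if $a_1\ne a_2,b_1=b_2$, and $\eta_1(a_1,a_1a_2)\wedge\varepsilon_2(b_1)\wedge\varepsilon_2(b_2)$ if $a_1\neq a_2,b_1\ne b_2$. *)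

(* Defs.v *)
From mathcomp Require Import all_boot all_order all_algebra.
From mathcomp Require Import reals.

Set Implicit Arguments.
Unset Strict Implicit.
Unset Printing Implicit Defensive.

Import Order.TTheory GRing.Theory Num.Theory.
Local Open Scope ring_scope.

(* The edge xy is present when [adj x y]; [inc x y] says that the incidence
   pair (x, xy) is present, so [inc y x] is about the other pair (y, xy) of the
   same edge and is independent of it.  [rho x y] is the weight of the edge xy
   and [eta x y] that of the pair (x, xy).  The values of [rho] on non-edges
   and of [eta] on absent pairs are irrelevant. *)
Record fig (R : realType) := Fig {
  vtx : finType;
  adj : rel vtx;
  inc : rel vtx;
  eps : vtx -> R;
  rho : vtx -> vtx -> R;
  eta : vtx -> vtx -> R;
  fig_vtx_gt0 : (0 < #|vtx|)%N;
  fig_adj_irr : forall x, ~~ adj x x;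
  fig_adj_sym : forall x y, adj x y = adj y x;
  fig_inc_adj : forall x y, inc x y -> adj x y;
  fig_eps_itv : forall x, 0 < eps x <= 1;
  fig_rho_itv : forall x y, adj x y -> 0 < rho x y <= 1;
  fig_eta_itv : forall x y, inc x y -> 0 < eta x y <= 1;
  fig_rho_sym : forall x y, adj x y -> rho x y = rho y x;
  fig_rho_le : forall x y, adj x y -> rho x y <= Num.min (eps x) (eps y);
  fig_eta_le : forall x y, inc x y -> eta x y <= Num.min (eps x) (rho x y)
}.

Section StrongPairs.
Variables (R : realType) (X : fig R).
Implicit Types (a b x y : vtx X) (p : seq (vtx X)).

Definition inc_step : rel (vtx X) :=
  fun x y => [&& adj x y, inc x y & inc y x].

(* With x_0 = a and p = [:: x_1; ...; x_k], this is the incidence path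
   x_0, (x_0, x_0x_1), x_0x_1, (x_1, x_0x_1), x_1, ..., x_k = b, (b, ab), ab.
   Since 2 <= k and the x_i are distinct, it never uses the pair (a, ab). *)
Definition inc_path a b p : bool :=
  [&& (2 <= size p)%N, path inc_step a p, uniq (a :: p), last a p == b
    & inc b a].

(* The pairs of the path are the two pairs of each edge x_i x_(i+1), and
   finally (b, ab). *)
Definition inc_strength a b p : R :=
  \big[Num.min/eta b a]_(e <- zip (a :: p) p)
     Num.min (eta e.1 e.2) (eta e.2 e.1).

(* The x_i being distinct, k < #|vtx X|. *)
Definition iconn a b : R :=
  \big[Num.max/0]_(k < #|vtx X|)
     \big[Num.max/0]_(p : k.-tuple (vtx X) | inc_path a b p)
        inc_strength a b p.

Definition strong_pair a b : Prop := iconn a b <= eta a b.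

Definition sfig : Prop := forall a b, inc a b -> strong_pair a b.

(* Weights lie in (0, 1], so the default values 0 and 1 only matter when there
   is no pair at all. *)
Definition max_pair_weight : R :=
  \big[Num.max/0]_(e : vtx X * vtx X | inc e.1 e.2) eta e.1 e.2.

Definition min_pair_weight : R :=
  \big[Num.min/1]_(e : vtx X * vtx X | inc e.1 e.2) eta e.1 e.2.

End StrongPairs.

Section Composition.
Variables (R : realType) (X1 X2 : fig R).

Let V : finType := (vtx X1 * vtx X2)%type.
Implicit Types u v : V.

Definition comp_adj : rel V := fun u v =>
  ((u.1 == v.1) && adj u.2 v.2) || adj u.1 v.1.

Definition comp_inc : rel V := fun u v =>
  [&& u.1 == v.1, inc u.2 v.2 & inc v.2 u.2]
  || (inc u.1 v.1 && inc v.1 u.1).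

Definition comp_eps u : R := Num.min (eps u.1) (eps u.2).

Definition comp_rho u v : R :=
  if u.1 == v.1 then Num.min (eps u.1) (rho u.2 v.2)
  else if u.2 == v.2 then Num.min (rho u.1 v.1) (eps u.2)
  else Num.min (rho u.1 v.1) (Num.min (eps u.2) (eps v.2)).

Definition comp_eta u v : R :=
  if u.1 == v.1 then Num.min (eps u.1) (eta u.2 v.2)
  else if u.2 == v.2 then Num.min (eta u.1 v.1) (eps u.2)
  else Num.min (eta u.1 v.1) (Num.min (eps u.2) (eps v.2)).

Lemma comp_vtx_gt0 : (0 < #|V|)%N.
Proof. by rewrite card_prod muln_gt0 !fig_vtx_gt0. Qed.

Lemma comp_adj_irr u : ~~ comp_adj u u.
Proof. by rewrite /comp_adj eqxx /= negb_or !fig_adj_irr. Qed.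

Lemma comp_adj_sym u v : comp_adj u v = comp_adj v u.
Proof.
by rewrite /comp_adj eq_sym (fig_adj_sym u.2) (fig_adj_sym u.1).
Qed.

Lemma comp_inc_adj u v : comp_inc u v -> comp_adj u v.
Proof.
rewrite /comp_inc /comp_adj => /orP[/and3P[-> /fig_inc_adj -> _] //|].
by case/andP=> /fig_inc_adj ->; rewrite orbT.
Qed.

Lemma comp_adjP u v : comp_adj u v ->
  if u.1 == v.1 then adj u.2 v.2 else adj u.1 v.1.
Proof.
rewrite /comp_adj; case: eqP => [->|_] //= /orP[//|].
by rewrite (negPf (fig_adj_irr _)).
Qed.

Lemma comp_incP u v : comp_inc u v ->
  if u.1 == v.1 then inc u.2 v.2 else inc u.1 v.1.
Proof.
rewrite /comp_inc; case: eqP => [->|_] /=; last by case/andP.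
case/orP=> [/andP[] //|/andP[/fig_inc_adj]].
by rewrite (negPf (fig_adj_irr _)).
Qed.

Lemma comp_eps_itv u : 0 < comp_eps u <= 1.
Proof.
have /andP[p1 q1] := fig_eps_itv u.1; have /andP[p2 _] := fig_eps_itv u.2.
by rewrite /comp_eps lt_min p1 p2 /= ge_min q1.
Qed.

Lemma comp_rho_sym u v : comp_adj u v -> comp_rho u v = comp_rho v u.
Proof.
move/comp_adjP; rewrite /comp_rho [v.1 == _]eq_sym [v.2 == _]eq_sym.
case: eqP => [-> /fig_rho_sym -> //|_ /fig_rho_sym ->].
by case: eqP => [-> //|_]; rewrite [Num.min (eps u.2) _]minC.
Qed.

Lemma comp_rho_le u v :
  comp_adj u v -> comp_rho u v <= Num.min (comp_eps u) (comp_eps v).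
Proof.
move/comp_adjP; rewrite /comp_rho /comp_eps.
case: eqP => [-> /fig_rho_le|_ /fig_rho_le]; rewrite le_min => /andP[h1 h2].
  by rewrite !le_min !ge_min lexx h1 h2 !orbT.
by case: eqP => [->|_]; rewrite !le_min !ge_min lexx h1 h2 ?lexx !orbT.
Qed.

Lemma comp_rho_itv u v : comp_adj u v -> 0 < comp_rho u v <= 1.
Proof.
move=> uv; apply/andP; split; last first.
  apply: le_trans (comp_rho_le uv) _; rewrite ge_min.
  by have /andP[_ ->] := comp_eps_itv u.
have e1 := fig_eps_itv u.1; have e2 := fig_eps_itv u.2.
have e3 := fig_eps_itv v.2; move: e1 e2 e3 => /andP[e1 _] /andP[e2 _] /andP[e3 _].
move: uv => /comp_adjP; rewrite /comp_rho.
by case: eqP => _ /fig_rho_itv/andP[h _]; last case: eqP => _;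
  rewrite !lt_min ?e1 ?e2 ?e3 h.
Qed.

Lemma comp_eta_le u v :
  comp_inc u v -> comp_eta u v <= Num.min (comp_eps u) (comp_rho u v).
Proof.
move/comp_incP; rewrite /comp_eta /comp_eps /comp_rho.
case: eqP => [_ /fig_eta_le|_ /fig_eta_le]; rewrite le_min => /andP[h1 h2].
  by rewrite !le_min !ge_min lexx h1 h2 !orbT.
by case: eqP => _; rewrite !le_min !ge_min ?lexx h1 h2 ?lexx !orbT.
Qed.

Lemma comp_eta_itv u v : comp_inc u v -> 0 < comp_eta u v <= 1.
Proof.
move=> uv; apply/andP; split; last first.
  apply: le_trans (comp_eta_le uv) _; rewrite ge_min.
  by have /andP[_ ->] := comp_eps_itv u.
have e1 := fig_eps_itv u.1; have e2 := fig_eps_itv u.2.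
have e3 := fig_eps_itv v.2; move: e1 e2 e3 => /andP[e1 _] /andP[e2 _] /andP[e3 _].
move: uv => /comp_incP; rewrite /comp_eta.
by case: eqP => _ /fig_eta_itv/andP[h _]; last case: eqP => _;
  rewrite !lt_min ?e1 ?e2 ?e3 h.
Qed.

Definition composition : fig R :=
  Fig comp_vtx_gt0 comp_adj_irr comp_adj_sym comp_inc_adj comp_eps_itv
      comp_rho_itv comp_eta_itv comp_rho_sym comp_rho_le comp_eta_le.

End Composition.

(* Main.v *)
Require Import Defs.
From mathcomp Require Import all_boot all_order all_algebra.
From mathcomp Require Import reals.
Local Open Scope ring_scope.
Import Order.TTheory.
Set Implicit Arguments.
Unset Strict Implicit.
Unset Printing Implicit Defensive.

(** Fix a threshold [t] and keep only the edges both of whose pairs have weight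
    at least [t].  A pair [(a, ab)] is strong iff it has weight at least [t]
    whenever [(b, ab)] has and [a], [b] are connected by the kept edges.
    In the composition, the weight of [(v, uv)] bounds all the vertex weights
    entering that of [(u, uv)].  If [u] and [v] lie in different fibers over
    [X1], connections project to [X1]; if they lie in the same fiber, then
    either [t] exceeds all the weights of [X1], connections stay in the fiber
    and project to [X2], or [t] is below all the weights of [X2]. *)

Lemma le_bigmin_seq (R : realType) (I : Type) (s : seq I) (F : I -> R) (x t : R) :
  (t <= \big[Num.min/x]_(i <- s) F i) = (t <= x) && all (fun i => t <= F i) s.
Proof.
elim: s => [|i s IHs]; first by rewrite big_nil andbT.
by rewrite big_cons le_min IHs /= andbCA.
Qed.

(** Asking only for [connect] in the image lets [h] collapse a step to a point, as the projection to
    [X1] does inside a fiber. *)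
Lemma connect_homo (T T' : finType) (e : rel T) (e' : rel T') (h : T -> T') :
  (forall x y, e x y -> connect e' (h x) (h y)) ->
  forall x y, connect e x y -> connect e' (h x) (h y).
Proof.
move=> he x y /connectP[p + ->]; elim: p x => [|z p IHp] x //=.
by case/andP=> /he xz /IHp; apply: connect_trans.
Qed.

Section Threshold.
Variables (R : realType) (X : fig R).
Implicit Types (a b x y : vtx X) (t : R).

Lemma inc_neq a b : inc a b -> a != b.
Proof.
by move/fig_inc_adj; apply: contraTneq => ->; apply: fig_adj_irr.
Qed.

Definition level_step t : rel (vtx X) := fun x y =>
  [&& inc x y, inc y x, t <= eta x y & t <= eta y x].

Lemma path_level_step t a p :
  path (level_step t) a p = path (@inc_step R X) a p &&
  all (fun e => t <= Num.min (eta e.1 e.2) (eta e.2 e.1)) (zip (a :: p) p).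
Proof.
elim: p a => [|x p IHp] a //=; rewrite IHp /level_step /inc_step le_min.
case ax: (inc a x); last by rewrite andbF.
by rewrite (fig_inc_adj ax) /= -!andbA; do !bool_congr.
Qed.

(** A connection shortens to a simple path. With at least two edges it competes in [iconn a b]; a
    single edge is [ab] itself, kept only if [t <= eta a b]. *)
Lemma strong_pair_level a b t : strong_pair a b -> inc a b -> inc b a ->
  t <= eta b a -> connect (level_step t) a b -> t <= eta a b.
Proof.
move=> sab ab ba tba /connectP[p0 ptp0 b_last].
case/shortenP: ptp0 b_last => p ptp Up _ b_last.
have [p_gt1|] := ltnP 1 (size p); last first.
  case: p ptp b_last {Up} => [|x [|//]] /= => [_ ba_eq|].
    by move: (inc_neq ab); rewrite ba_eq eqxx.
  by rewrite andbT => /and4P[_ _ tax _] ->.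
move: ptp; rewrite path_level_step => /andP[ipp tp].
have ip : inc_path a b p by rewrite /inc_path p_gt1 ipp Up -b_last eqxx ba.
have ltk : (size p < #|vtx X|)%N.
  by rewrite -[(size p).+1]/(size (a :: p)) -(card_uniqP Up) max_card.
apply: le_trans sab; rewrite /iconn.
apply: le_trans (le_bigmax _ _ (Ordinal ltk)).
apply: le_trans (le_bigmax_cond _ (inc_strength a b) (j := in_tuple p) ip).
by rewrite le_bigmin_seq tba.
Qed.

Lemma level_strong_pair a b : inc a b ->
  (forall t, inc b a -> t <= eta b a -> connect (level_step t) a b ->
    t <= eta a b) -> strong_pair a b.
Proof.
move=> ab level_ab.
(* Covers the default value 0 of both maxima in [iconn]. *)
have eta_ge0 : 0 <= eta a b by case/andP: (fig_eta_itv ab) => /ltW.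
apply: bigmax_le => // k _; apply: bigmax_le => // p.
(* The threshold is the strength of the path itself, so all its edges are kept. *)
case/and5P=> _ ipp _ /eqP b_last ba; have := lexx (inc_strength a b p).
rewrite {2}/inc_strength le_bigmin_seq => /andP[tba tp].
apply: level_ab => //; apply/connectP; exists (val p) => //.
by rewrite path_level_step ipp.
Qed.

Lemma eta_le_max_pair_weight a b : inc a b -> eta a b <= max_pair_weight X.
Proof.
exact: (le_bigmax_cond _ (fun e => eta e.1 e.2) (j := (a, b))).
Qed.

Lemma min_pair_weight_le_eta a b : inc a b -> min_pair_weight X <= eta a b.
Proof.
exact: (bigmin_le_cond _ (fun e => eta e.1 e.2) (j := (a, b))).
Qed.

End Threshold.

Section CompositionLevel.
Variables (R : realType) (X1 X2 : fig R) (t : R).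
Implicit Types u v : vtx (composition X1 X2).

(** [comp_eta] is a minimum with a pair weight of one factor among its terms, so [t] bounds that
    weight too. *)
Lemma comp_level_step u v : level_step t u v ->
  if u.1 == v.1 then level_step t u.2 v.2 else level_step t u.1 v.1.
Proof.
case/and4P=> /comp_incP + /comp_incP; rewrite /= /comp_eta /level_step.
rewrite [v.1 == _]eq_sym [v.2 == _]eq_sym.
case: eqP => _ -> ->; first by rewrite !le_min => /andP[_ ->] /andP[_ ->].
by case: eqP => _; rewrite !le_min => /andP[-> _] /andP[-> _].
Qed.

Lemma connect_comp_fst u v :
  connect (level_step t) u v -> connect (level_step t) u.1 v.1.
Proof.
apply: (connect_homo (h := fun w : vtx X1 * vtx X2 => w.1)) => x y.
by move/comp_level_step; case: eqP => [-> _|_ /connect1].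
Qed.

Lemma connect_comp_snd u v : max_pair_weight X1 < t ->
  connect (level_step t) u v -> connect (level_step t) u.2 v.2.
Proof.
move=> lt_t.
apply: (connect_homo (h := fun w : vtx X1 * vtx X2 => w.2)) => x y.
(* A step between fibers would give a pair of [X1] of weight at least [t], above the maximum. *)
move/comp_level_step; case: eqP => [_ /connect1 //|_ /and4P[xy _ txy _]].
have := le_trans txy (eta_le_max_pair_weight xy).
by rewrite leNgt lt_t.
Qed.

End CompositionLevel.

Theorem theorem6p4 (R : realType) (X1 X2 : fig R) :
  sfig X1 -> sfig X2 ->
  max_pair_weight X1 <= min_pair_weight X2 ->
  sfig (composition X1 X2).
Proof.
move=> s1 s2 le12 u v uv; apply: level_strong_pair => // t vu tvu cuv.
have := comp_incP uv; have := comp_incP vu; move: tvu.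
rewrite /= /comp_eta [v.1 == _]eq_sym [v.2 == _]eq_sym.
case: eqP => [eq_uv|_] tvu vu' uv'.
  (* The common vertex weight [eps v.1] is at least [t], which leaves [eta u.2 v.2] to bound. *)
  move: tvu; rewrite !le_min eq_uv => /andP[-> tvu] /=.
  have [le_t|lt_t] := leP t (max_pair_weight X1).
    exact: le_trans le_t (le_trans le12 (min_pair_weight_le_eta uv')).
  apply: strong_pair_level (s2 _ _ uv') uv' vu' tvu _.
  exact: connect_comp_snd lt_t cuv.
(* Reversing the pair changes only its [X1] weight; the vertex weights are the same both ways. *)
have tX1 : t <= eta v.1 u.1 -> t <= eta u.1 v.1.
  move=> tvu1; apply: strong_pair_level (s1 _ _ uv') uv' vu' tvu1 _.
  exact: connect_comp_fst cuv.
move: tvu; case: eqP => [->|_]; rewrite !le_min; first by case/andP=> /tX1-> ->.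
by case/and3P=> /tX1-> -> ->.
Qed.
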